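(* Let $f$ be a valid function on $A\times\mathbb{R}$ that is strictly log-concave with respect to $y$, and consider the pairwise comparison sampling model described in the context (latent scores $u\in\mathbb{R}^n$ with dynamic range $M_n$, comparison counts $n_{ij}\sim\mathrm{Bin}(T,p_{ij,n})$, minimum comparison rate $p_n$). Let $$C_n^{(1)}=\int_{[0,\infty)} f(x;M_n)\,dx .$$ Suppose that $$\frac{\log n}{n p_n\,\bigl|\log C_n^{(1)}\bigr|}\to 0\quad\text{as } n\to\infty .$$ Then for all sufficiently large $n$, with probability at least $1-n^{-3}$, the following condition holds: for every non-empty $V_1\subsetneq [n]$ there exist $i\in V_1$, $j\in [n]\setminus V_1$ and $t\in\{1,\dots,n_{ij}\}$ such that $X_{ij}^{(t)}>0$. Consequently, with probability $1$, the maximum likelihood estimator $$\widehat{u}=\arg\max_{v\in\mathbb{R}^n,\ v_1=0} l(v)$$ uniquely exists for all but finitely many $n$.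
   Context: **Link function.** $A\subset\mathbb{R}$ is symmetric ($A=-A$) and is either continuous (integrals over $A$ are with respect to Lebesgue measure) or discrete (integrals $\int\cdot\,dx$ are read as sums over $A$). A function $f:A\times\mathbb{R}\to(0,\infty)$ is *valid* if: (1) $\int_A f(x;y)\,dx=1$ for every $y\in\mathbb{R}$; (2) $f(x;y)=f(-x;-y)$ for all $(x,y)\in A\times\mathbb{R}$; (3) for every $x\in A$ with $x<0$, $f(x;y)$ is decreasing in $y$ and $f(x;y)\to0$ as $y\to\infty$; (4) $\sup_{y\in\mathbb{R}}f(x;y)<\infty$ for every $x\in A$. $f$ is *strictly log-concave with respect to $y$* if for every $x\in A$, $\log f(x;y)$ is twice differentiable in $y$ and $\frac{\partial^2}{\partial y^2}\log f(x;y)<0$ for all $y\in\mathbb{R}$. $A$ and $f$ do not depend on $n$. **Sampling model.** For each $n$ there is a latent score vector $u=(u_1,\dots,u_n)\in\mathbb{R}^n$ (depending on $n$) with $u_1=0$, and $M_n=\max_{i,j}|u_i-u_j|$. $T\ge1$ is a fixed integer. For each pair $i\ne j$ there is a comparison rate $p_{ij,n}=p_{ji,n}\in(0,1]$, and $p_n=\min_{i\neq j}p_{ij,n}$. The numbers of comparisons $n_{ij}=n_{ji}$ are independent over pairs $i<j$, with $n_{ij}\sim\mathrm{Bin}(T,p_{ij,n})$. Given $\{n_{ij}\}$, the outcomes $X_{ij}^{(t)}$ ($i<j$, $1\le t\le n_{ij}$) are independent with density (mass function) $f(\cdot\,;u_i-u_j)$, and $X_{ji}^{(t)}=-X_{ij}^{(t)}$.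 The models for all $n$ are defined on a common probability space. **Log-likelihood.** $l(v)=\frac12\sum_{i\ne j}\sum_{t=1}^{n_{ij}}\log f(X_{ij}^{(t)};v_i-v_j)$ for $v\in\mathbb{R}^n$. The displayed limit hypothesis in particular requires $C_n^{(1)}<1$ for large $n$. *)

(* Defs.v *)
From HB Require Import structures.
From mathcomp Require Import all_boot all_order all_algebra.
From mathcomp Require Import all_classical all_reals all_analysis.

Set Implicit Arguments.
Unset Strict Implicit.
Unset Printing Implicit Defensive.

Import Order.TTheory GRing.Theory Num.Theory.
Import numFieldNormedType.Exports.

Local Open Scope classical_set_scope.
Local Open Scope ring_scope.

Variant outcome_kind := Continuous | Discrete.

Definition outcome_space (R : realType) (k : outcome_kind) (A : set R) : Prop :=
  (forall x, A x -> A (- x)) /\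
  match k with
  | Continuous => measurable A
  | Discrete => countable A
  end.

(* The integral of g over A `&` B: a Lebesgue integral if A is continuous, a
   sum if A is discrete. It is only applied to functions g that are
   nonnegative on A, for which esum is the usual (possibly infinite) sum. *)
Definition integral_over (R : realType) (k : outcome_kind) (A B : set R)
    (g : R -> R) : \bar R :=
  match k with
  | Continuous => (\int[lebesgue_measure]_(x in A `&` B) (g x)%:E)%E
  | Discrete => esum (A `&` B) (fun x => (g x)%:E)
  end.

(* A function A * R -> (0, +oo) is represented by a total f : R -> R -> R whose
   values f x y with x outside A are irrelevant. *)
Record valid_link (R : realType) (k : outcome_kind) (A : set R)
    (f : R -> R -> R) : Prop := ValidLink {
  link_gt0 : forall x y, A x -> 0 < f x y ;
  (* implicit in the normalization of the densities; automatic if A is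
     countable *)
  link_measurable : forall y, measurable_fun A (f ^~ y) ;
  link_integral1 : forall y, integral_over k A setT (f ^~ y) = 1%E ;
  link_sym : forall x y, A x -> f x y = f (- x) (- y) ;
  (* "decreasing" is taken in the weak sense; under strict log-concavity in y
     it is equivalent to the strict one *)
  link_decreasing : forall x, A x -> x < 0 ->
    forall y z, y <= z -> f x z <= f x y ;
  link_cvg0 : forall x, A x -> x < 0 -> f x y @[y --> +oo] --> (0 : R) ;
  link_bounded : forall x, A x -> has_ubound (range (f x)) }.

Definition strictly_log_concave (R : realType) (A : set R) (f : R -> R -> R) :
    Prop :=
  forall x, A x -> forall y,
    [/\ derivable (fun z => ln (f x z)) y 1,
        derivable (derive1 (fun z => ln (f x z))) y 1 &
        derive1 (derive1 (fun z => ln (f x z))) y < 0].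

(* The constraint v_1 = 0 (indices are shifted to start at 0). *)
Definition first_zero (R : realType) (n : nat) (v : 'rV[R]_n) : Prop :=
  forall i : 'I_n, nat_of_ord i = 0%N -> v ord0 i = 0.

Definition dynamic_range (R : realType) (n : nat) (u : 'rV[R]_n) : R :=
  \big[Num.max/0]_(i < n) \big[Num.max/0]_(j < n) `|u ord0 i - u ord0 j|.

(* As all rates are at most 1, the neutral element 1 does not affect the
   minimum as soon as n >= 2. *)
Definition min_rate (R : realType) (n : nat) (p : 'I_n -> 'I_n -> R) : R :=
  \big[Num.min/1]_(i < n) \big[Num.min/1]_(j < n | j != i) p i j.

Definition mutually_independent (R : realType) (d d' : measure_display)
    (Omega : measurableType d) (P : probability Omega R)
    (S : measurableType d') (I : finType) (Y : I -> {RV P >-> S}) : Prop :=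
  forall (J : {set I}) (B : I -> set S), (forall e, measurable (B e)) ->
    P [set w | forall e, e \in J -> B e (Y e w)] =
    (\prod_(e in J) P (Y e @^-1` B e))%E.

Definition pair_lt (n : nat) : finType := {e : 'I_n * 'I_n | (e.1 < e.2)%N}.

(* N i j is the number of comparisons between i and j, and X i j t, for
   t < N i j, is the outcome of the (t+1)-st of them. The variables X i j t
   with N i j <= t are not part of the data and are left unconstrained, as are
   the diagonal terms.
   The last field is the conditional law of the outcomes given the counts,
   multiplied by the probability of the values of the counts. *)
Record sampling_model (R : realType) (k : outcome_kind) (A : set R)
    (f : R -> R -> R) (T : nat) (d : measure_display)
    (Omega : measurableType d) (P : probability Omega R) (n : nat)
    (u : 'rV[R]_n) (p : 'I_n -> 'I_n -> R)
    (N : 'I_n -> 'I_n -> {RV P >-> nat})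
    (X : 'I_n -> 'I_n -> nat -> {RV P >-> R}) : Prop := SamplingModel {
  score_first : first_zero u ;
  rate_sym : forall i j : 'I_n, i != j -> p i j = p j i ;
  rate_itv : forall i j : 'I_n, i != j -> 0 < p i j <= 1 ;
  count_sym : forall (i j : 'I_n) w, i != j -> N i j w = N j i w ;
  count_binomial : forall i j : 'I_n, (i < j)%N -> forall U : set nat,
    distribution P (N i j) U = binomial_prob T (p i j) U ;
  count_indep :
    mutually_independent (fun e : pair_lt n => N (val e).1 (val e).2) ;
  outcome_antisym : forall (i j : 'I_n) t w, i != j -> (t < N i j w)%N ->
    X j i t w = - X i j t w ;
  outcome_law : forall (m : 'I_n -> 'I_n -> nat)
      (B : 'I_n -> 'I_n -> nat -> set R),
    (forall i j t, measurable (B i j t)) ->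
    P [set w | forall i j : 'I_n, (i < j)%N ->
         N i j w = m i j /\ forall t, (t < m i j)%N -> B i j t (X i j t w)] =
    (P [set w | forall i j : 'I_n, (i < j)%N -> N i j w = m i j] *
     \prod_(i < n) \prod_(j < n | (i < j)%N) \prod_(t < m i j)
       integral_over k A (B i j t)
         (fun x => f x (u ord0 i - u ord0 j)%R))%E }.

(* Here N and X are realized data. *)
Definition log_likelihood (R : realType) (f : R -> R -> R) (n : nat)
    (N : 'I_n -> 'I_n -> nat) (X : 'I_n -> 'I_n -> nat -> R) (v : 'rV[R]_n) :
    R :=
  2^-1 * \sum_(i < n) \sum_(j < n | j != i) \sum_(t < N i j)
    ln (f (X i j t) (v ord0 i - v ord0 j)).

Definition is_mle (R : realType) (f : R -> R -> R) (n : nat)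
    (N : 'I_n -> 'I_n -> nat) (X : 'I_n -> 'I_n -> nat -> R) (v : 'rV[R]_n) :
    Prop :=
  first_zero v /\
  forall v', first_zero v' ->
    log_likelihood f N X v' <= log_likelihood f N X v.

Definition cut_condition (R : realType) (n : nat) (N : 'I_n -> 'I_n -> nat)
    (X : 'I_n -> 'I_n -> nat -> R) : Prop :=
  forall V1 : {set 'I_n}, V1 != finset.set0 -> V1 \proper finset.setT ->
    exists i j t, [/\ i \in V1, j \notin V1, (t < N i j)%N & 0 < X i j t].

(* C_n^(1) as a function of the dynamic range M; a real number in [0, 1] for a
   valid link function. *)
Definition C1 (R : realType) (k : outcome_kind) (A : set R) (f : R -> R -> R)
    (M : R) : R :=
  fine (integral_over k A `[0, +oo[ (f ^~ M)).

(* Main.v *)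
(** Since [f] is decreasing in [y] for negative outcomes and symmetric, a given
comparison is not won with probability at most [C = C1 (M_n)]. Hence a pair yields
no win with probability at most [(1 - p (1 - C)) ^ T <= exp (- p_n (1 - C))], and,
the pairs being independent, no vertex of [V] wins against the complement of [V]
with probability at most [exp (- p_n (1 - C) |V| (n - |V|))]. As [C >= 1/2], the
factor [1 - C] is comparable to [|log C|], and the union bound over [V] gives
[n ^ -3].

Almost surely the cut condition then holds for all large [n], by Borel-Cantelli.
It makes the graph of observed wins strongly connected; as a term won by [i]
against [j] tends to -oo when [v_i - v_j] does, while all terms are bounded above,
the likelihood is coercive on [v_1 = 0] and attains its maximum. If two maximizers
differed, the cut condition applied to the set where they agree would give a term
whose strict concavity makes their midpoint better. *)
Require Import Defs.
From HB Require Import structures.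
From mathcomp Require Import all_boot all_order all_algebra.
From mathcomp Require Import all_classical all_reals all_analysis.
From mathcomp Require Import measurable_realfun zify ring lra.

Set Implicit Arguments.
Unset Strict Implicit.
Unset Printing Implicit Defensive.

Import Order.TTheory GRing.Theory Num.Theory.
Import numFieldNormedType.Exports.

Local Open Scope classical_set_scope.
Local Open Scope ring_scope.

(** * Outcome probabilities under the link function *)

Section integral_over.
Context (R : realType) (k : outcome_kind) (A : set R).
Hypothesis hA : outcome_space k A.
Implicit Types (B C : set R) (g h : R -> R).

Let I B g := integral_over k A B g.

Lemma integral_over_ge0 B g : (forall x, A x -> 0 <= g x) -> (0 <= I B g)%E.
Proof.
rewrite /I /integral_over => g0; case: k.
  by apply: integral_ge0 => x [Ax _]; rewrite lee_fin g0.
by apply: esum_ge0 => x [Ax _]; rewrite lee_fin g0.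
Qed.

Lemma integral_over_setC B g : measurable B -> measurable_fun A g ->
  (forall x, A x -> 0 <= g x) -> I setT g = (I B g + I (~` B) g)%E.
Proof.
case: hA => _; rewrite /I /integral_over setIT; case: k => kA mB mg g0.
  rewrite -[in LHS](setIT A) -(setUv B) setIUr ge0_integral_setU//=.
  - exact: measurableI.
  - by apply: measurableI => //; exact: measurableC.
  - by apply/measurable_EFinP; apply: measurable_funS mg => // x [] [].
  - by move=> x [] [Ax _]; rewrite lee_fin g0.
  - by rewrite disj_set2E setIACA setICr setI0.
by rewrite (esumID B)// => x Ax; rewrite lee_fin g0.
Qed.

Lemma subset_integral_over B C g : measurable B -> measurable C ->
  measurable_fun A g -> (forall x, A x -> 0 <= g x) -> B `<=` C ->
  (I B g <= I C g)%E.
Proof.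
case: hA => _; rewrite /I /integral_over; case: k => kA mB mC mg g0 BC.
  apply: ge0_subset_integral => //; try exact: measurableI.
  - by apply/measurable_EFinP; apply: measurable_funS mg => // x [].
  - by move=> x [Ax _]; rewrite lee_fin g0.
  - exact: setIS.
rewrite [leLHS]esum_mkcond [leRHS]esum_mkcond; apply: le_esum => x _.
case: ifPn => [|_]; last by case: ifPn => // /set_mem[Ax _]; rewrite lee_fin g0.
by move=> /set_mem[Ax Bx]; rewrite ifT//; apply/mem_set; split=> //; exact: BC.
Qed.

Lemma le_integral_over B g h : measurable B ->
  measurable_fun A g -> measurable_fun A h -> (forall x, A x -> 0 <= g x) ->
  (forall x, A x -> B x -> g x <= h x) -> (I B g <= I B h)%E.
Proof.
case: hA => _; rewrite /I /integral_over; case: k => kA mB mg mh g0 gh.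
  apply: ge0_le_integral => //; first exact: measurableI.
  - by move=> x [Ax _]; rewrite lee_fin g0.
  - by apply/measurable_EFinP; apply: measurable_funS mg => // x [].
  - by apply/measurable_EFinP; apply: measurable_funS mh => // x [].
  - by move=> x [Ax Bx]; rewrite lee_fin gh.
by apply: le_esum => x [Ax Bx]; rewrite lee_fin gh.
Qed.

(** Lebesgue measure is invariant under negation and [A] is symmetric; in the discrete case the sum
    is reindexed along negation. *)
Lemma integral_overN B g : measurable B ->
  measurable_fun A g -> (forall x, A x -> 0 <= g x) ->
  I B g = I (-%R @^-1` B) (fun x => g (- x)).
Proof.
case: hA; rewrite /I /integral_over => Asym.
have AN C : A `&` (-%R @^-1` C) = -%R @^-1` (A `&` C).
  apply/seteqP; split=> x /= [Ax Cx]; split => //; first exact: Asym.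
  by rewrite -(opprK x); exact: Asym.
rewrite AN; case: k => kA mB mg g0.
  have mAB : measurable (A `&` B) by exact: measurableI.
  rewrite -(@ge0_integral_pushforward _ _ _ _ _
    (-%R : measurableTypeR R -> measurableTypeR R) _ _ _ (EFin \o g))//=.
  - by apply: eq_measure_integral => C mC _; exact/esym/lebesgue_measureN.
  - by apply/measurable_EFinP; apply: measurable_funS mg => // x [].
  - by move=> x /set_mem[Ax _]; rewrite lee_fin g0.
apply: reindex_esum; split.
- by move=> x.
- by move=> x y _ _; exact: oppr_inj.
- by move=> y ABy; exists (- y); rewrite /= opprK.
Qed.

Lemma integral_over_in_outcomes g : I A g = I setT g.
Proof. by rewrite /I /integral_over setIid setIT. Qed.

End integral_over.

Section link_mass.
Context (R : realType) (k : outcome_kind) (A : set R) (f : R -> R -> R).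
Hypotheses (hA : outcome_space k A) (hf : valid_link k A f).
Implicit Types (B C : set R) (M y : R).

Let q B y := integral_over k A B (f ^~ y).

Let f_ge0 y x : A x -> 0 <= f x y.
Proof. by move=> Ax; apply: ltW; apply: (link_gt0 hf). Qed.

Let f_meas y := link_measurable hf y.

Lemma link_mass_ge0 B y : (0 <= q B y)%E.
Proof. by apply: integral_over_ge0 => x Ax; exact: f_ge0. Qed.

Lemma link_mass_setC B y : measurable B -> (q B y + q (~` B) y = 1)%E.
Proof.
move=> mB; rewrite -(link_integral1 hf y); apply/esym.
exact: (integral_over_setC hA mB (f_meas y) (@f_ge0 y)).
Qed.

Lemma link_mass_le1 B y : measurable B -> (q B y <= 1)%E.
Proof.
by move=> mB; rewrite -(link_mass_setC y mB) leeDl//; exact: link_mass_ge0.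
Qed.

Lemma link_mass_fin_num B y : measurable B -> q B y \is a fin_num.
Proof.
move=> mB; rewrite fin_numE gt_eqF ?lt_eqF//.
  by rewrite (le_lt_trans (link_mass_le1 y mB))// ltry.
by rewrite (lt_le_trans _ (link_mass_ge0 B y)).
Qed.

Lemma link_massN B y : measurable B -> q B y = q (-%R @^-1` B) (- y).
Proof.
move=> mB; rewrite /q (integral_overN hA mB (f_meas y) (@f_ge0 y)).
have [Asym _] := hA.
have fN x : A x -> f (- x) y = f x (- y).
  by move=> Ax; rewrite (link_sym hf _ (Asym _ Ax)) opprK.
rewrite /integral_over; case: k.
  by apply: eq_integral => x /set_mem[Ax _]; rewrite fN.
by apply: eq_esum => x [Ax _]; rewrite fN.
Qed.

Lemma link_mass_neg_nonincr y M : y <= M ->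
  (q `]-oo, 0%R[ M <= q `]-oo, 0%R[ y)%E.
Proof.
move=> yM.
apply: (le_integral_over hA _ (f_meas M) (f_meas y) (@f_ge0 M)) => // x Ax.
rewrite /= in_itv/= => x0.
exact: (link_decreasing hf).
Qed.

Lemma C1E M : (C1 k A f M)%:E = q `[0%R, +oo[ M.
Proof. by rewrite /C1 fineK// link_mass_fin_num. Qed.

(** Monotonicity in [y] is available only for negative outcomes; since the two complementary masses
    sum to 1, it transfers with reversed direction to the nonnegative ones. *)
Lemma link_mass_nonneg_le y M : y <= M ->
  (q `[0%R, +oo[ y <= (C1 k A f M)%:E)%E.
Proof.
move=> yM; rewrite C1E.
have := link_mass_neg_nonincr yM.
have sumE z := link_mass_setC z (measurable_itv `[0%R, +oo[%R).
have := sumE y; have := sumE M; rewrite setCitvr.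
have fin_q z (i : interval R) : q [set` i] z = (fine (q [set` i] z))%:E.
  by rewrite fineK//; exact: (link_mass_fin_num z (measurable_itv i)).
rewrite (fin_q y `[0%R, +oo[%R) (fin_q M `[0%R, +oo[%R).
rewrite (fin_q y `]-oo, 0%R[%R) (fin_q M `]-oo, 0%R[%R) -!EFinD !lee_fin.
by move=> [h1] [h2]; lra.
Qed.

(** Negating both the outcome and the score difference reduces this to nonnegative outcomes. The
    outcome 0 is kept on both sides, as it is a win for neither. *)
Lemma link_mass_nonpos_le y M : - y <= M ->
  (q `]-oo, 0%R] y <= (C1 k A f M)%:E)%E.
Proof.
move=> yM; rewrite link_massN// (_ : -%R @^-1` _ = `[0%R, +oo[%classic).
  exact: link_mass_nonneg_le.
by apply/seteqP; split=> x; rewrite /= !in_itv/= oppr_le0 andbT.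
Qed.

Lemma C1_le1 M : C1 k A f M <= 1.
Proof. by rewrite -lee_fin C1E link_mass_le1. Qed.

(* For M >= 0, a negative x is at most as likely as -x. *)
Lemma C1_ge_half M : 0 <= M -> 2^-1 <= C1 k A f M.
Proof.
move=> M0.
have negE : (q `]-oo, 0%R[ M <= (C1 k A f M)%:E)%E.
  apply: le_trans (link_mass_nonpos_le (y := M) _); last by lra.
  apply: (subset_integral_over hA _ _ (f_meas M) (@f_ge0 M)) => // x /=.
  by rewrite !in_itv/= => /ltW.
have := link_mass_setC M (measurable_itv `[0%R, +oo[%R).
rewrite setCitvr -C1E; move: negE.
rewrite -(fineK (link_mass_fin_num M (measurable_itv `]-oo, 0%R[%R))) -EFinD.
by rewrite lee_fin => h [h']; lra.
Qed.

End link_mass.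

(** * Law of the data *)

Lemma measurable_forall d (T : measurableType d) (I : countType)
    (F : I -> set T) :
  (forall i, measurable (F i)) -> measurable [set w | forall i, F i w].
Proof.
move=> mF; rewrite (_ : [set w | _] = ~` \bigcup_i ~` F i).
  apply: measurableC; apply: countable_bigcupT_measurable => // i.
  exact: measurableC.
apply/seteqP; split=> [w Fw [i _]|w nF i]; first exact.
by apply: contrapT => nFi; apply: nF; exists i.
Qed.

Lemma measurable_impl d (T : measurableType d) (b : Prop) (F : set T) :
  (b -> measurable F) -> measurable [set w | b -> F w].
Proof.
move=> mF; have [hb|nb] := pselect b.
  rewrite (_ : [set w | _] = F); first exact: mF.
  by apply/seteqP; split=> w //=; apply.
rewrite (_ : [set w | _] = setT)//.
by apply/seteqP; split=> w //=.
Qed.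

Section finite_families.
Context d (T : measurableType d) (R : realType)
  (mu : {measure set T -> \bar R}) (I : finType) (F : I -> set T).

Lemma measure_bigcup_finType : trivIset setT F ->
  (forall i, measurable (F i)) -> mu (\bigcup_i F i) = (\sum_i mu (F i))%E.
Proof.
move=> tF mF; rewrite measure_fin_bigcup //; last exact: finite_finset.
rewrite [RHS]fsbig_seq ?index_enum_uniq//.
by apply: eq_fsbigl; apply/seteqP; split=> // i _ /=; rewrite mem_index_enum.
Qed.

Lemma measure_bigcup_finType_le : (forall i, measurable (F i)) ->
  (mu (\bigcup_i F i) <= \sum_i mu (F i))%E.
Proof.
move=> mF; rewrite (_ : \bigcup_i F i = \big[setU/set0]_i F i); last first.
  rewrite -bigcup_seq; apply/seteqP; split=> w [i _ Fiw]; exists i => //=.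
  by rewrite mem_index_enum.
elim: (index_enum I) => [|i r IH]; first by rewrite !big_nil measure0.
rewrite !big_cons (le_trans (measureU2 _ _ _))//.
  exact: bigsetU_measurable.
by rewrite leeD2l.
Qed.

End finite_families.

Section outcome_probabilities.
Context (R : realType) (k : outcome_kind) (A : set R) (f : R -> R -> R)
  (T : nat) (d : measure_display) (Omega : measurableType d)
  (P : probability Omega R)
  (n : nat) (u : 'rV[R]_n) (p : 'I_n -> 'I_n -> R)
  (N : 'I_n -> 'I_n -> {RV P >-> nat})
  (X : 'I_n -> 'I_n -> nat -> {RV P >-> R}).
Hypotheses (hA : outcome_space k A) (hf : valid_link k A f)
  (hm : sampling_model k A f T u p N X).

Let q (B : 'I_n -> 'I_n -> set R) i j : R :=
  fine (integral_over k A (B i j) (f ^~ (u ord0 i - u ord0 j))).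

(* The counts m, extended by the junk value 0 to the pairs (i, j) with j <= i. *)
Let ext (m : {ffun pair_lt n -> 'I_T.+1}) (i j : 'I_n) : nat :=
  if insub (i, j) is Some e then m e else 0%N.

Let extE m (e : pair_lt n) : ext m (val e).1 (val e).2 = m e.
Proof. by rewrite /ext -surjective_pairing valK. Qed.

Lemma prod_pair_lt (F : 'I_n -> 'I_n -> R) :
  \prod_(i < n) \prod_(j < n | (i < j)%N) F i j =
  \prod_(e : pair_lt n) F (val e).1 (val e).2.
Proof.
rewrite pair_big_dep/=.
exact: (@big_sub _ _ _ _ [pred e : 'I_n * 'I_n | (e.1 < e.2)%N]
  (fun e => F e.1 e.2)).
Qed.

Let counts m := [set w | forall i j : 'I_n, (i < j)%N -> N i j w = ext m i j].

Lemma count_eq_measurable (i j : 'I_n) c :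
  measurable [set w | N i j w = c].
Proof. exact: (measurable_funPTI (N i j) (Y := [set c])). Qed.

Lemma counts_probability m :
  P (counts m) = (\prod_(e : pair_lt n)
    binomial_pmf T (p (val e).1 (val e).2) (m e))%:E.
Proof.
rewrite (_ : counts m = [set w | forall e : pair_lt n,
    e \in [set: pair_lt n]%SET -> [set (m e : nat)] (N (val e).1 (val e).2 w)]);
  last first.
  apply/seteqP; split=> w /= cw.
    by move=> e _; rewrite cw ?extE//; exact: (valP e).
  move=> i j ij; have := cw (exist _ (i, j) ij) (finset.in_setT _).
  by rewrite /= => ->; rewrite -extE.
rewrite [LHS](count_indep hm [set: pair_lt n]%SET
  (B := fun e => [set (m e : nat)]))//.
rewrite -prodEFin; apply: eq_big => e; first by rewrite finset.in_setT.
move=> _.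
have := count_binomial hm (valP e) [set (m e : nat)].
rewrite /distribution /pushforward => ->.
have ne : (val e).1 != (val e).2.
  by apply: contraTneq (valP e) => /= ->; rewrite ltnn.
have /andP[p0 p1] := rate_itv hm ne.
(* [binomial_prob] is given by the mass function only for a parameter in [0, 1]; the bounds on the
   rate select that case. *)
rewrite /binomial_prob (ltW p0) p1/= esum_set1// lee_fin.
by rewrite binomial_pmf_ge0// (ltW p0).
Qed.

Variable B : 'I_n -> 'I_n -> set R.
Hypothesis mB : forall i j, measurable (B i j).

Let data m := [set w | forall i j : 'I_n, (i < j)%N ->
  N i j w = ext m i j /\ forall t, (t < ext m i j)%N -> B i j (X i j t w)].

Let hit := [set w | forall i j : 'I_n, (i < j)%N ->
  forall t, (t < N i j w)%N -> B i j (X i j t w)].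

(** The binomial law bounds the counts only almost surely. On this event the count vectors range
    over a finite type, so that [hit] splits into finitely many events [data m]. *)
Let bounded := [set w | forall e : pair_lt n, (N (val e).1 (val e).2 w <= T)%N].

Lemma outcome_in_measurable (i j : 'I_n) t :
  measurable [set w | B i j (X i j t w)].
Proof. exact: (measurable_funPTI (X i j t) (mB i j)). Qed.

Lemma data_measurable m : measurable (data m).
Proof.
apply: measurable_forall => i; apply: measurable_forall => j.
apply: measurable_impl => _.
apply: (@measurableI _ _ [set w | N i j w = _]).
  exact: count_eq_measurable.
apply: measurable_forall => t; apply: measurable_impl => _.
exact: outcome_in_measurable.
Qed.

Lemma hit_measurable : measurable hit.
Proof.
apply: measurable_forall => i; apply: measurable_forall => j.
apply: measurable_impl => _; apply: measurable_forall => t.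
rewrite [X in measurable X](_ : _ =
    ~` (N i j @^-1` [set c | (t < c)%N]) `|` [set w | B i j (X i j t w)]).
  apply: measurableU; last exact: outcome_in_measurable.
  by apply: measurableC; exact: measurable_funPTI.
apply/seteqP; split=> w /=; last by case.
by have [tN|] := boolP (t < N i j w)%N; [right; auto|left].
Qed.

Lemma bounded_measurable : measurable bounded.
Proof.
apply: measurable_forall => e.
exact: (measurable_funPTI (N (val e).1 (val e).2) (Y := [set c | (c <= T)%N])).
Qed.

Lemma data_probability m : P (data m) =
  (\prod_(e : pair_lt n) (binomial_pmf T (p (val e).1 (val e).2) (m e) *
    q B (val e).1 (val e).2 ^+ m e))%:E.
Proof.
rewrite (outcome_law hm (ext m) (fun i j _ => mB i j)) counts_probability.
rewrite big_split/= EFinM; congr (_ * _)%E.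
under [in RHS]eq_bigr do rewrite -extE.
rewrite -(prod_pair_lt (fun i j => q B i j ^+ ext m i j)) -prodEFin.
apply: eq_bigr => i _; rewrite -prodEFin; apply: eq_bigr => j _.
rewrite -[X in (_ ^+ X)]card_ord -prodr_const -prodEFin.
by apply: eq_bigr => t _; rewrite /q fineK// (link_mass_fin_num hA hf).
Qed.

Lemma data_trivIset : trivIset setT data.
Proof.
move=> m m' _ _ [w [wm wm']]; apply/ffunP => e; apply: val_inj.
rewrite /= -!extE.
by have [<- _] := wm _ _ (valP e); have [<- _] := wm' _ _ (valP e).
Qed.

Lemma hit_boundedE : hit `&` bounded = \bigcup_m data m.
Proof.
apply/seteqP; split=> [w [hw bw]|w [m _ wm]]; last first.
  split=> [i j ij t|e]; first by have [->] := wm _ _ ij; apply.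
  have [-> _] := wm _ _ (valP e).
  by rewrite extE -ltnS.
pose m : {ffun pair_lt n -> 'I_T.+1} :=
  [ffun e => inord (N (val e).1 (val e).2 w)].
have NE (i j : 'I_n) : (i < j)%N -> N i j w = ext m i j.
  move=> ij; have := extE m (exist _ (i, j) ij); rewrite /= => ->.
  by rewrite ffunE inordK// ltnS; exact: bw.
exists m => // i j ij; split; first exact: NE.
by move=> t; rewrite -NE//; exact: hw.
Qed.

(** By distributivity, the sum over all count vectors of a product over pairs is a product of sums
    over single counts. Each such sum is the generating function of a binomial law, evaluated at the
    mass of [B]. *)
Lemma hit_bounded_probability : P (hit `&` bounded) =
  (\prod_(e : pair_lt n) (1 - p (val e).1 (val e).2 *
     (1 - q B (val e).1 (val e).2)) ^+ T)%:E.
Proof.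
rewrite hit_boundedE measure_bigcup_finType; last 2 first.
- exact: data_trivIset.
- exact: data_measurable.
rewrite (eq_bigr _ (fun m _ => data_probability m)).
rewrite sumEFin -(bigA_distr_bigA (fun (e : pair_lt n) (c : 'I_T.+1) =>
  binomial_pmf T (p (val e).1 (val e).2) c * q B (val e).1 (val e).2 ^+ c)).
congr (_%:E); apply: eq_bigr => e _.
set a := p _ _; set b := q _ _ _.
rewrite (_ : 1 - a * (1 - b) = (1 - a) + a * b); last by ring.
rewrite exprDn; apply: eq_bigr => c _.
by rewrite /binomial_pmf mulrnAl exprMn mulrCA mulrA.
Qed.

End outcome_probabilities.

Section sampling_events.
Context (R : realType) (k : outcome_kind) (A : set R) (f : R -> R -> R)
  (T : nat) (d : measure_display) (Omega : measurableType d)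
  (P : probability Omega R)
  (n : nat) (u : 'rV[R]_n) (p : 'I_n -> 'I_n -> R)
  (N : 'I_n -> 'I_n -> {RV P >-> nat})
  (X : 'I_n -> 'I_n -> nat -> {RV P >-> R}).
Hypotheses (hA : outcome_space k A) (hf : valid_link k A f)
  (hm : sampling_model k A f T u p N X).

Let q (B : set R) i j : R :=
  fine (integral_over k A B (f ^~ (u ord0 i - u ord0 j))).

(** With the whole line as target set for every pair, all factors of [hit_bounded_probability] equal
    1. *)
Lemma counts_bounded_probability :
  P [set w | forall e : pair_lt n, (N (val e).1 (val e).2 w <= T)%N] = 1%E.
Proof.
have := hit_bounded_probability hA hf hm (fun i j => @measurableT _ R).
rewrite (_ : _ `&` _ =
    [set w | forall e : pair_lt n, (N (val e).1 (val e).2 w <= T)%N]).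
  move=> ->; congr (_%:E); rewrite big1// => e _.
  by rewrite (link_integral1 hf) subrr mulr0 subr0 expr1n.
by apply/seteqP; split=> w => [[]|?]//; split.
Qed.

Lemma hit_probability (B : 'I_n -> 'I_n -> set R) :
  (forall i j, measurable (B i j)) ->
  P [set w | forall i j : 'I_n, (i < j)%N ->
       forall t, (t < N i j w)%N -> B i j (X i j t w)] =
  (\prod_(e : pair_lt n) (1 - p (val e).1 (val e).2 *
     (1 - q (B (val e).1 (val e).2) (val e).1 (val e).2)) ^+ T)%:E.
Proof.
move=> mB; rewrite -(hit_bounded_probability hA hf hm mB).
set H := [set w | _]; set D := [set w | _].
have mH : measurable H by exact: hit_measurable.
have mD : measurable D by exact: bounded_measurable.
(* [D] has probability 1, so the part of [H] outside [D] is null. *)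
rewrite [LHS](measureDI P mH mD) [X in (X + _)%E](_ : _ = 0%E) ?add0e//.
apply/eqP; rewrite -measure_le0 -(subee (x := 1%E))//.
rewrite -[X in (_ - X)%E]counts_bounded_probability.
rewrite -probability_setC//; apply: le_measure; rewrite ?inE.
- exact: measurableD.
- exact: measurableC.
- by move=> w [].
Qed.

Lemma outcome_space_measurable : measurable A.
Proof. by case: hA => _; case: k => // /countable_measurable; apply. Qed.

(** The properties of the link hold only for outcomes in [A], while the variables take values in the
    whole line. The target set [A] has mass 1 for every pair; the pairs with [j < i] follow from the
    symmetry of [A]. *)
Lemma outcomes_in_space : {ae P, forall w, forall i j t, i != j ->
  (t < N i j w)%N -> A (X i j t w)}.
Proof.
have mA := outcome_space_measurable.
pose H := [set w | forall i j : 'I_n, (i < j)%N ->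
  forall t, (t < N i j w)%N -> A (X i j t w)].
have mH : measurable H.
  exact: (@hit_measurable _ _ _ _ _ N X (fun _ _ => A) (fun _ _ => mA)).
have PH : P H = 1%E.
  rewrite (hit_probability (B := fun _ _ => A))//; congr (_%:E).
  rewrite big1// => e _.
  rewrite /q integral_over_in_outcomes (link_integral1 hf).
  by rewrite subrr mulr0 subr0 expr1n.
exists (~` H); split; first exact: measurableC.
  by rewrite probability_setC// PH subee.
move=> w; apply: contra_not => Hw i j t ij tN.
move: (ij); rewrite neq_ltn => /orP[ltij|ltji]; first exact: Hw.
rewrite eq_sym in ij; rewrite (count_sym hm) 1?eq_sym// in tN.
rewrite (outcome_antisym hm ij tN).
by case: hA => Asym _; apply/Asym/Hw.
Qed.

(** * Vertex sets without a win against their complement *)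

Definition no_win (V : {set 'I_n}) := [set w | forall i j : 'I_n, i \in V ->
  j \notin V -> forall t, (t < N i j w)%N -> X i j t w <= 0].

Lemma no_win_measurable V : measurable (no_win V).
Proof.
apply: measurable_forall => i; apply: measurable_forall => j.
apply: measurable_impl => _; apply: measurable_impl => _.
apply: measurable_forall => t.
rewrite [X in measurable X](_ : _ =
    ~` (N i j @^-1` [set c | (t < c)%N]) `|` X i j t @^-1` `]-oo, 0]).
  apply: measurableU; first by apply: measurableC; exact: measurable_funPTI.
  exact: measurable_funPTI.
apply/seteqP; split=> w /=; rewrite in_itv/=; last by case.
by have [tN|] := boolP (t < N i j w)%N; [right; auto|left].
Qed.

(** The two trivial sets contribute [set0], so that the union runs over a whole finite type. *)
Lemma not_cut_condition :
  ~` [set w | cut_condition (fun i j => N i j w) (fun i j t => X i j t w)] =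
  \bigcup_(V : {set 'I_n}) if (V != finset.set0) && (V \proper finset.setT)
                            then no_win V else set0.
Proof.
apply/seteqP; split=> w /=.
  move=> /existsNP[V] /not_implyP[V0] /not_implyP[VT] nV.
  exists V; rewrite // V0 VT => i j iV jV t tN; rewrite leNgt; apply/negP => X0.
  by apply: nV; exists i, j, t.
move=> [V _]; case: ifP => // /andP[V0 VT] nV /(_ V V0 VT).
move=> [i [j [t [iV jV tN X0]]]].
by have := nV i j iV jV t tN; rewrite leNgt X0.
Qed.

(** Each pair [i < j] collects its two orientations. The cardinality product of a cut counts ordered
    pairs, whereas the law of the data is a product over pairs [i < j]. *)
Lemma prod_pair_lt_sym (F : 'I_n -> 'I_n -> R) : (forall i, F i i = 1) ->
  \prod_i \prod_j F i j =
  \prod_(e : pair_lt n) (F (val e).1 (val e).2 * F (val e).2 (val e).1).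
Proof.
move=> Fii; rewrite -(prod_pair_lt (fun i j => F i j * F j i)).
under [RHS]eq_bigr do rewrite big_split/=.
rewrite big_split/= [X in _ = _ * X](exchange_big_dep xpredT)//= -big_split/=.
apply: eq_bigr => i _; rewrite (bigID (fun j : 'I_n => i < j)%N)/=.
congr (_ * _).
rewrite (bigD1 i) ?ltnn//= Fii mul1r; apply: eq_bigl => j.
by rewrite -leqNgt ltn_neqAle andbC.
Qed.

Lemma no_win_probability (V : {set 'I_n}) (pm C : R) : (1 <= T)%N ->
  0 <= pm -> (forall i j, i != j -> pm <= p i j) -> C <= 1 ->
  (forall i j, (integral_over k A `]-oo, 0%R]
    (f ^~ (u ord0 i - u ord0 j)%R) <= C%:E)%E) ->
  (forall i j, (integral_over k A `[0%R, +oo[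
    (f ^~ (u ord0 i - u ord0 j)%R) <= C%:E)%E) ->
  (P (no_win V) <= ((1 - pm * (1 - C)) ^+ (#|V| * #|~: V|))%:E)%E.
Proof.
move=> T1 pm0 pmp C1 qn qp.
(* For a pair [i < j] across the cut, the member of [V] may be either index; if it is [j], its
   failure to win means a nonnegative [X i j t] by antisymmetry. Pairs on one side of the cut are
   unconstrained. *)
pose B i j := if (i \in V) && (j \notin V) then `]-oo, 0]%classic
  else if (i \notin V) && (j \in V) then `[0, +oo[%classic else @setT R.
have mB i j : measurable (B i j) by rewrite /B; case: ifP => // _; case: ifP.
have mH := hit_measurable N X mB.
apply: (@le_trans _ _ (P [set w | forall i j : 'I_n, (i < j)%N ->
    forall t, (t < N i j w)%N -> B i j (X i j t w)])).
  apply: le_measure; rewrite ?inE//; first exact: no_win_measurable.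
  move=> w nV i j ij t tN; rewrite /B.
  case: ifP => [/andP[iV jV]|_]; first by rewrite /= in_itv/= nV.
  case: ifP => [/andP[iV jV]|//]; rewrite /= in_itv/= andbT.
  have ne : j != i by rewrite neq_ltn ij orbT.
  rewrite (count_sym hm) in tN; last by rewrite eq_sym.
  by rewrite (outcome_antisym hm ne tN) oppr_ge0 nV.
rewrite (hit_probability mB) lee_fin.
set x := 1 - pm * (1 - C).
(* The factor [x] appears once for each ordered pair leaving [V], hence [#|V| * #|~: V|] times. *)
pose F i j := if (i \in V) && (j \notin V) then x else 1.
have -> : x ^+ (#|V| * #|~: V|) = \prod_i \prod_j F i j.
  rewrite mulnC exprM -prodr_const big_mkcond/=; apply: eq_bigr => i _.
  rewrite /F; case: (i \in V) => /=; last by rewrite big1.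
  by rewrite -prodr_const big_mkcond/=; apply: eq_bigr => j _; rewrite inE.
rewrite prod_pair_lt_sym; last by move=> i; rewrite /F andbN.
apply: ler_prod => e _; set i := (val e).1; set j := (val e).2.
have ij : i != j by rewrite neq_ltn (valP e : (i < j)%N).
have /andP[p0 p1] := rate_itv hm ij.
have pmij := pmp _ _ ij.
have q0 : 0 <= q (B i j) i j.
  by apply: fine_ge0; exact: (link_mass_ge0 hf).
have qE : (q (B i j) i j)%:E =
    integral_over k A (B i j) (f ^~ (u ord0 i - u ord0 j)%R).
  by rewrite fineK//; exact: (link_mass_fin_num hA hf).
have q1 : q (B i j) i j <= 1 by rewrite -lee_fin qE (link_mass_le1 hA hf).
have qle b : (integral_over k A (B i j) (f ^~ (u ord0 i - u ord0 j)%R)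
    <= b%:E)%E -> q (B i j) i j <= b.
  by rewrite -lee_fin qE.
have b0 : 0 <= 1 - p i j * (1 - q (B i j) i j) by nra.
have b1 : 1 - p i j * (1 - q (B i j) i j) <= 1 by nra.
rewrite exprn_ge0//=.
(* Only one of the [T] potential comparisons is exploited: the base lies in [0, 1] and [T] is at
   least 1. *)
have le1 : (1 - p i j * (1 - q (B i j) i j)) ^+ T <=
    1 - p i j * (1 - q (B i j) i j).
  by rewrite -[leRHS]expr1 ler_wiXn2l.
apply: (le_trans le1).
have qC : q (B i j) i j <= C -> 1 - p i j * (1 - q (B i j) i j) <= x.
  by rewrite /x => h; nra.
rewrite /F; case: (boolP (i \in V)) => iV; case: (boolP (j \in V)) => jV /=;
  rewrite ?mulr1 ?mul1r//.
  by apply/qC/qle; rewrite /B iV jV/=; exact: qn.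
by apply/qC/qle; rewrite /B (negbTE iV) jV/=; exact: qp.
Qed.

End sampling_events.

(** * Existence and uniqueness of the maximum likelihood estimator *)

Lemma MVT_derivable (R : realType) (h : R -> R) (a b : R) :
  (forall y, derivable h y 1) -> a < b ->
  exists c, [/\ a < c, c < b & h b - h a = derive1 h c * (b - a)].
Proof.
move=> dh ab.
have [x _||c] := @MVT R h (derive1 h) a b ab.
- by rewrite derive1E; apply/derivableP.
- by apply: derivable_within_continuous => x _; exact: dh.
by rewrite in_itv/= => /andP[ac cb] E; exists c.
Qed.

(** The mean value theorem gives the slopes of [g] on the two halves of the interval; applied to the
    derivative, it shows that the second slope is strictly smaller. *)
Lemma strict_midpoint_concave (R : realType) (g : R -> R) :
  (forall y, derivable g y 1) -> (forall y, derivable (derive1 g) y 1) ->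
  (forall y, derive1 (derive1 g) y < 0) ->
  forall a b, a != b -> g a + g b < 2 * g (2^-1 * (a + b)).
Proof.
move=> dg d2g g2 a b; wlog ab : a b / a < b => [H|_].
  rewrite neq_lt => /orP[ab|ba]; first by apply: H => //; rewrite lt_eqF.
  by rewrite addrC (addrC a); apply: H => //; rewrite lt_eqF.
set m := 2^-1 * (a + b).
have am : a < m by rewrite /m; lra.
have mb : m < b by rewrite /m; lra.
have [c [ac cm E1]] := MVT_derivable dg am.
have [c' [mc' cb' E2]] := MVT_derivable dg mb.
have cc' : c < c' by apply: lt_trans mc'.
have [x [_ _ E3]] := MVT_derivable d2g cc'.
have d1 : derive1 g c' < derive1 g c.
  by rewrite -subr_lt0 E3 pmulr_llt0 ?subr_gt0.
have bmE : b - m = m - a by rewrite /m; lra.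
rewrite bmE in E2.
have : 0 < (derive1 g c - derive1 g c') * (m - a) by rewrite mulr_gt0 ?subr_gt0.
rewrite mulrBl -E1 -E2; lra.
Qed.

(** * Maximizers of sums of concave functions of coordinate differences *)

Section difference_sums.
Context (R : realType) (n : nat) (I : finType) (a b : I -> 'I_n.+1)
  (g : I -> R -> R).

Let L (v : 'rV[R]_n.+1) := \sum_e g e (v ord0 (a e) - v ord0 (b e)).
Let tends_to_ninfty e := forall c, exists D, forall y, y <= D -> g e y < c.

Hypothesis g_cont : forall e, continuous (g e).
Hypothesis g_bounded : forall e, exists K, forall y, g e y <= K.
Hypothesis g_concave : forall e x y, x != y ->
  g e x + g e y < 2 * g e (2^-1 * (x + y)).
Hypothesis g_cut : forall V : {set 'I_n.+1}, V != finset.set0 ->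
  V \proper finset.setT ->
  exists e, [/\ a e \in V, b e \notin V & tends_to_ninfty e].

Lemma difference_sum_continuous : continuous L.
Proof.
apply: continuous_big => [|e _ v]; first exact: add_continuous.
apply: continuous_comp; last exact: g_cont.
by apply: (@continuousB _ R^o); apply: coord_continuous.
Qed.

Let edge : rel 'I_n.+1 := fun i j =>
  [exists e, [&& `[< tends_to_ninfty e >], a e == i & b e == j]].

(** The set of vertices reachable from [i] has no outgoing edge; were it proper, [g_cut] would
    provide one. *)
Lemma difference_sum_connect i j : connect edge i j.
Proof.
apply: contrapT => nij.
pose V : {set 'I_n.+1} := finset.finset (connect edge i).
have iV : i \in V by rewrite inE.
have jV : j \notin V by rewrite inE; apply/negP.
have V0 : V != finset.set0 by apply/set0Pn; exists i.
have VT : V \proper finset.setT.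
  by rewrite properT; apply: contraNneq jV => ->; rewrite finset.in_setT.
have [e [aV bV We]] := g_cut V0 VT.
move/negP : bV; rewrite !inE in aV *; apply.
apply: connect_trans aV _; apply: connect1.
by apply/existsP; exists e; rewrite !eqxx !andbT; apply/asboolP.
Qed.

(* As every summand is bounded above, a lower bound on L bounds each summand
   from below, hence the differences of v along the edges. *)
Lemma difference_sum_coercive c : exists B, 0 <= B /\
  forall v, c <= L v -> forall i j, v ord0 i - v ord0 j >= - B.
Proof.
have [K gK] := choice g_bounded.
pose Km := \sum_e `|K e|.
have term v e : c <= L v -> c - Km <= g e (v ord0 (a e) - v ord0 (b e)).
  move=> cL; rewrite lerBlDr (le_trans cL)// /L (bigD1 e)//= lerD2l.
  rewrite /Km [leRHS](bigD1 e)//= -[leLHS]add0r lerD// ler_sum// => e' _.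
  exact: le_trans (gK _ _) (ler_norm _).
have /choice[D gD] : forall e, exists D, tends_to_ninfty e ->
    forall y, y <= D -> g e y < c - Km.
  move=> e; have [We|nW] := pselect (tends_to_ninfty e); last by exists 0.
  by have [D HD] := We (c - Km); exists D.
pose Dm := \sum_e `|D e|.
have Dm0 : 0 <= Dm by apply: sumr_ge0.
have step v i j : c <= L v -> edge i j -> - Dm <= v ord0 i - v ord0 j.
  move=> cL /existsP[e /and3P[/asboolP We /eqP <- /eqP <-]].
  rewrite leNgt; apply/negP => lt.
  have := term v e cL; rewrite leNgt => /negP; apply; apply: gD => //.
  rewrite (le_trans (ltW lt))// lerNl (le_trans (ler_norm _))// normrN.
  by rewrite /Dm (bigD1 e)//= lerDl sumr_ge0.
(* Any two vertices are joined by a path without repetition, hence with at most [n.+1] edges; each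
   edge contributes at least [- Dm] to the difference. *)
exists (n.+1%:R * Dm); split; first by rewrite mulr_ge0.
move=> v cL i j.
have /connectP[q qe ->] := difference_sum_connect i j.
case/shortenP: qe => s se us _.
have size_s : (size s <= n.+1)%N.
  by rewrite -[X in (_ <= X)%N]card_ord -(card_uniqP (andP us).2) max_card.
have path_le (l : seq 'I_n.+1) : forall i0, path edge i0 l ->
    - ((size l)%:R * Dm) <= v ord0 i0 - v ord0 (last i0 l).
  elim: l => [|x l IH] i0 /=; first by rewrite mul0r subrr oppr0.
  move=> /andP[/(step _ _ _ cL) h /IH{}IH].
  by rewrite -addn1 natrD; lra.
apply: le_trans (path_le _ _ se).
by rewrite lerN2 ler_wpM2r// ler_nat.
Qed.

Lemma difference_sum_has_max : exists v : 'rV[R]_n.+1, v ord0 ord0 = 0 /\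
  forall v' : 'rV[R]_n.+1, v' ord0 ord0 = 0 -> L v' <= L v.
Proof.
have [B [B0 HB]] := difference_sum_coercive (L 0).
(* Radius 0 at the first coordinate puts the box inside the constraint set. *)
pose bd (i : 'I_n.+1) := if i == ord0 then 0 else B.
pose box := [set v : 'rV[R]_n.+1 |
  forall i, `[- bd i, bd i]%classic (v ord0 i)].
have cbox : compact box.
  apply: (@rV_compact _ _ (fun i => `[- bd i, bd i]%classic)) => i.
  exact: segment_compact.
have box0 : box 0.
  move=> i; rewrite /= mxE in_itv/= /bd; case: ifP => _; rewrite ?oppr0 ?lexx//.
  by rewrite oppr_le0 B0.
have [||w wbox wmax] := @EVT_max_rV R _ L box _ cbox.
- by exists 0.
- exact/continuous_subspaceT/difference_sum_continuous.
rewrite inE in wbox; exists w; split.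
  have := wbox ord0; rewrite /= in_itv/= /bd eqxx oppr0 => /andP[h1 h2].
  by apply/eqP; rewrite eq_le h1 h2.
(* A point with a value below [L 0] is beaten by the origin, which lies in the box; any other
   admissible point lies in the box by coercivity, through its differences with the first
   coordinate. *)
move=> v v0; have [lt|ge] := ltP (L v) (L 0).
  by apply: (le_trans (ltW lt)); apply: wmax; rewrite inE.
apply: wmax; rewrite inE => i /=.
have h1 := HB _ ge i ord0; have h2 := HB _ ge ord0 i.
rewrite v0 subr0 in h1; rewrite v0 sub0r lerN2 in h2.
rewrite in_itv/= /bd; case: eqP => [->|_]; first by rewrite v0 oppr0 lexx.
by rewrite h1 h2.
Qed.

Lemma difference_sum_unique_max : exists! v : 'rV[R]_n.+1, v ord0 ord0 = 0 /\
  forall v' : 'rV[R]_n.+1, v' ord0 ord0 = 0 -> L v' <= L v.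
Proof.
have [v [v0 vmax]] := difference_sum_has_max.
(* Two maximizers differ across the cut V below, on a summand along which the
   midpoint is strictly better. *)
exists v; split => // w [w0 wmax]; apply: contrapT => vw.
pose V : {set 'I_n.+1} := finset.finset (fun i => v ord0 i == w ord0 i).
have V0 : V != finset.set0 by apply/set0Pn; exists ord0; rewrite inE v0 w0.
have VT : V \proper finset.setT.
  rewrite properT; apply/eqP => VT; apply: vw; apply/rowP => i.
  by have := finset.in_setT i; rewrite -VT inE => /eqP.
have [e [aV bV _]] := g_cut V0 VT; rewrite !inE in aV bV.
pose m : 'rV[R]_n.+1 := 2^-1 *: (v + w).
have m0 : m ord0 ord0 = 0 by rewrite !mxE v0 w0 addr0 mulr0.
have mE (i j : 'I_n.+1) : m ord0 i - m ord0 j =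
    2^-1 * ((v ord0 i - v ord0 j) + (w ord0 i - w ord0 j)).
  by rewrite !mxE; lra.
have : L v + L w < 2 * L m.
  rewrite /L mulr_sumr -big_split/= (bigD1 e)//= [ltRHS](bigD1 e)//=.
  apply: ltr_leD.
    rewrite mE; apply: g_concave; rewrite (eqP aV).
    by apply: contra bV => /eqP h; apply/eqP; lra.
  apply: ler_sum => e' _; rewrite mE.
  set x := v ord0 _ - _; set y := w ord0 _ - _.
  have [->|ne] := eqVneq x y; last by apply: ltW; apply: g_concave.
  rewrite (_ : 2^-1 * (y + y) = y); lra.
have := vmax _ m0; have := wmax _ m0; lra.
Qed.

End difference_sums.

(** By symmetry [f x y] equals [f (- x) (- y)], and the link vanishes at +oo for the negative
    outcome [- x]. *)
Lemma link_log_tends_to_ninfty (R : realType) (k : outcome_kind) (A : set R)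
    (f : R -> R -> R) (x : R) :
  outcome_space k A -> valid_link k A f -> A x -> 0 < x ->
  forall c, exists D, forall y, y <= D -> ln (f x y) < c.
Proof.
move=> [Asym _] hf Ax x0 c.
have Anx := Asym _ Ax.
have nx0 : - x < 0 by rewrite oppr_lt0.
have /cvgrPdist_lt/(_ (expR c) (expR_gt0 c)) := link_cvg0 hf Anx nx0.
move=> [M [_ HM]].
(* The neighbourhood of +oo consists of the points strictly above [M], hence the margin 1. *)
exists (- (M + 1)) => y yM.
have fy : 0 < f x y by apply: (link_gt0 hf).
rewrite -[c]expRK ltr_ln ?posrE ?expR_gt0//.
have /= := HM (- y); rewrite -(link_sym hf _ Ax) sub0r normrN gtr0_norm//.
by apply; lra.
Qed.

(** This is [difference_sum_unique_max] with one summand per off-diagonal comparison; the positive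
    factor [2^-1] does not change the maximizers. A win across a cut is a summand that tends to
    -oo. *)
Lemma cut_condition_unique_mle (R : realType) (k : outcome_kind) (A : set R)
    (f : R -> R -> R) (n : nat) (N : 'I_n.+1 -> 'I_n.+1 -> nat)
    (X : 'I_n.+1 -> 'I_n.+1 -> nat -> R) :
  outcome_space k A -> valid_link k A f -> strictly_log_concave A f ->
  (forall i j t, i != j -> (t < N i j)%N -> A (X i j t)) ->
  cut_condition N X -> exists! v, is_mle f N X v.
Proof.
move=> hA hf hconc AX cut.
pose J := {ij : 'I_n.+1 * 'I_n.+1 & 'I_(N ij.1 ij.2)}.
pose offdiag := [pred e : J | (tag e).2 != (tag e).1].
pose I := {e in offdiag}.
pose outcome (e : I) := X (tag (val e)).1 (tag (val e)).2 (tagged (val e)).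
pose g (e : I) y := ln (f (outcome e) y).
have Ae (e : I) : A (outcome e).
  by apply: AX => //; rewrite eq_sym; exact: (valP e).
pose L (v : 'rV[R]_n.+1) := \sum_(e : I)
  g e (v ord0 (tag (val e)).1 - v ord0 (tag (val e)).2).
have LE v : log_likelihood f N X v = 2^-1 * L v.
  rewrite /log_likelihood /L; congr (_ * _).
  rewrite pair_big_dep/=
    (@sig_big_dep _ _ _ _ (fun ij : 'I_n.+1 * 'I_n.+1 => 'I_(N ij.1 ij.2))
      (fun ij => ij.2 != ij.1) (fun _ => predT)
      (fun ij t => ln (f (X ij.1 ij.2 t) (v ord0 ij.1 - v ord0 ij.2))))/=.
  rewrite -[RHS](big_sub _ (fun e : J => ln (f
    (X (tag e).1 (tag e).2 (tagged e))
    (v ord0 (tag e).1 - v ord0 (tag e).2)))) /=.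
  by apply: eq_bigl => e; rewrite inE andbT.
have [e|e|e x y|V V0 VT|v [[v0 vmax] vuniq]] := @difference_sum_unique_max R n I
  (fun e => (tag (val e)).1) (fun e => (tag (val e)).2) g.
- move=> y; apply: differentiable_continuous; apply/derivable1_diffP.
  by have [] := hconc _ (Ae e) y.
- have [K HK] := link_bounded hf (Ae e); exists (ln K) => y.
  have f0 : 0 < f (outcome e) y by apply: (link_gt0 hf).
  have fK : f (outcome e) y <= K by apply: HK; exists y.
  by rewrite ler_ln ?posrE// (lt_le_trans f0).
- by apply: strict_midpoint_concave => z; have [] := hconc _ (Ae e) z.
- have [i [j [t [iV jV tN X0]]]] := cut V V0 VT.
  have ij : (i, j).2 != (i, j).1 by apply: contraNneq jV => /= ->.
  pose e0 : J := Tagged (fun ij : 'I_n.+1 * 'I_n.+1 => 'I_(N ij.1 ij.2))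
    (Ordinal tN : 'I_(N (i, j).1 (i, j).2)).
  have oe : e0 \in offdiag by [].
  exists (exist _ e0 oe); split => //.
  by apply: (link_log_tends_to_ninfty hA hf (Ae _)).
have fz (w : 'rV[R]_n.+1) : first_zero w <-> w ord0 ord0 = 0.
  split; first exact.
  by move=> w0 i i0; rewrite (_ : i = ord0)//; exact: val_inj.
have mleE w : is_mle f N X w <-> w ord0 ord0 = 0 /\
    forall w' : 'rV[R]_n.+1, w' ord0 ord0 = 0 -> L w' <= L w.
  rewrite /is_mle fz; split=> -[-> h]; split => // w' /fz/h; rewrite !LE.
    by rewrite ler_pM2l.
  by rewrite ler_pM2l.
exists v; split; first exact/mleE.
by move=> w /mleE/vuniq.
Qed.

(** * Union bound over the cuts *)

(** The subsets are grouped by cardinality and the binomial theorem applies. *)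
Lemma sum_set_expr (R : comNzRingType) (n : nat) (y : R) :
  \sum_(V : {set 'I_n}) y ^+ #|V| = (1 + y) ^+ n.
Proof.
rewrite exprDn.
rewrite (partition_big (fun V : {set 'I_n} => inord #|V| : 'I_n.+1) xpredT)//=.
apply: eq_bigr => c _; rewrite expr1n mul1r.
have cE (V : {set 'I_n}) : (inord #|V| == c) = (#|V| == c).
  rewrite -val_eqE/= inordK// ltnS -[X in (_ <= X)%N]card_ord; exact: max_card.
rewrite (eq_bigl _ _ cE) (eq_bigr (fun=> y ^+ c)); last by move=> V /eqP ->.
by rewrite sumr_const -[X in 'C(X, _)]card_ord -card_draws cardsE.
Qed.

(** With [z = n y], the power is at most [exp z], which is at most [1 / (1 - z)], and this is at
    most [1 + 2 z] for [z] in [0, 1/2]. *)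
Lemma expr1D_le (R : realType) (n : nat) (y : R) : 0 <= y -> n%:R * y <= 2^-1 ->
  (1 + y) ^+ n <= 1 + 2 * (n%:R * y).
Proof.
move=> y0; set z := n%:R * y => z2.
have z0 : 0 <= z by rewrite mulr_ge0.
apply: (@le_trans _ _ (expR z)).
  by rewrite /z expRM_natl lerXn2r ?nnegrE ?expR_ge0 ?addr_ge0// expR_ge1Dx.
have h := expR_ge1Dx (- z); rewrite expRN in h.
have e0 := expR_gt0 z.
have : expR z * (1 - z) <= 1.
  by rewrite -ler_pdivlMl// mulr1 h.
nra.
Qed.

(** The larger of the two sides has at least half of the [n] vertices. *)
Lemma card_cut_ge (n : nat) (V : {set 'I_n}) :
  (n * minn #|V| #|~: V| <= 2 * (#|V| * #|~: V|))%N.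
Proof.
have := cardsC V; rewrite card_ord; move: #|V| #|~: V| => a b <-.
rewrite mulnDl mul2n -addnn; case: (leqP a b) => ab.
  by rewrite leq_add// ?[(b * _)%N]mulnC// leq_mul.
by rewrite leq_add// leq_mul// ltnW.
Qed.

(* With y = exp (- n a / 2), the summand is at most y ^ min (#|V|, #|~: V|), so
   the sum is at most 2 ((1 + y) ^ n - 1); and y <= n ^ -5. *)
Lemma sum_cuts_le (R : realType) (n : nat) (a : R) : (4 <= n)%N ->
  0 <= a <= 1 -> 10 * ln n%:R <= n%:R * a ->
  \sum_(V : {set 'I_n} | (V != finset.set0) && (V \proper finset.setT))
     (1 - a) ^+ (#|V| * #|~: V|) <= n%:R ^- 3.
Proof.
move=> n4 /andP[a0 a1] na.
pose y := expR (- (n%:R * a / 2)).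
have n0 : 0 < n%:R :> R by rewrite ltr0n; apply: leq_trans n4.
have n4R : 4 <= n%:R :> R by rewrite ler_nat.
have y0 : 0 <= y by exact: expR_ge0.
have yn : y <= n%:R ^- 5.
  rewrite -[n%:R]lnK ?posrE// -expRM_natl -expRN ler_expR; lra.
have term (V : {set 'I_n}) :
    (1 - a) ^+ (#|V| * #|~: V|) <= y ^+ #|V| + y ^+ #|~: V|.
  apply: (@le_trans _ _ (y ^+ minn #|V| #|~: V|)); last first.
    rewrite /minn; case: ifP => _; first by rewrite lerDl exprn_ge0.
    by rewrite lerDr exprn_ge0.
  apply: (@le_trans _ _ (expR (- a) ^+ (#|V| * #|~: V|))).
    by rewrite lerXn2r ?nnegrE ?expR_ge0 ?subr_ge0// expR_ge1Dx.
  rewrite -!expRM_natl ler_expR.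
  have := card_cut_ge V; rewrite -(ler_nat R) !natrM; nra.
(* Each of the two sums is enlarged to omit a single set, the one with exponent 0, so that it
   becomes a full binomial sum minus 1. *)
apply: (@le_trans _ _ (\sum_(V : {set 'I_n} | V != finset.set0) y ^+ #|V| +
    \sum_(V : {set 'I_n} | V \proper finset.setT) y ^+ #|~: V|)).
  rewrite [X in _ <= X + _](bigID
    (fun V : {set 'I_n} => V \proper finset.setT))/=.
  rewrite [X in _ <= _ + X](bigID
    (fun V : {set 'I_n} => V != finset.set0))/=.
  have s0 (Q : pred {set 'I_n}) (F : {set 'I_n} -> nat) :
      0 <= \sum_(V | Q V) y ^+ F V.
    by apply: sumr_ge0 => V _; exact: exprn_ge0.
  rewrite [X in _ + (X + _)](eq_bigl (fun V : {set 'I_n} =>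
    (V != finset.set0) && (V \proper finset.setT))); last first.
    by move=> V; rewrite andbC.
  rewrite addrACA -[leLHS]addr0 lerD ?addr_ge0//.
  by rewrite -big_split/= ler_sum// => V _; exact: term.
have half : \sum_(V : {set 'I_n} | V != finset.set0) y ^+ #|V| =
    (1 + y) ^+ n - 1.
  rewrite -sum_set_expr [in RHS](bigD1 finset.set0)//= cards0 expr0.
  by rewrite addrC addrK.
have -> : \sum_(V : {set 'I_n} | V \proper finset.setT) y ^+ #|~: V| =
    (1 + y) ^+ n - 1.
  rewrite -half (reindex_inj (@finset.setC_inj _))/=; apply: eq_big => V.
    by rewrite properT -finset.setC0 (inj_eq (@finset.setC_inj _)).
  by move=> _; rewrite finset.setCK.
rewrite half.
have ny : n%:R * y <= n%:R ^- 4.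
  apply: (le_trans (ler_wpM2l (ltW n0) yn)).
  by rewrite exprS invfM mulrA mulfV ?gt_eqF// mul1r.
(* The two sums are each at most [2 n y], in total at most [4 n ^ -4]; the factor 4 is absorbed by
   [n >= 4]. *)
have n3 : n%:R ^- 4 <= n%:R ^- 3 / 4 :> R.
  rewrite exprSr invfM ler_wpM2l ?invr_ge0 ?exprn_ge0 ?(ltW n0)//.
  by rewrite lef_pV2 ?posrE.
have n31 : n%:R ^- 3 <= 1 :> R.
  by rewrite invf_le1 ?exprn_gt0// exprn_ege1//; lra.
have := expr1D_le (n := n) y0; lra.
Qed.

Section dynamic_range.
Context (R : realType) (n : nat).

Lemma dynamic_range_ge0 (u : 'rV[R]_n) : 0 <= dynamic_range u.
Proof. exact: bigmax_ge_id. Qed.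

Lemma le_dynamic_range (u : 'rV[R]_n) i j :
  `|u ord0 i - u ord0 j| <= dynamic_range u.
Proof.
rewrite /dynamic_range (le_trans _ (le_bigmax _ _ i))//.
exact: (le_bigmax _ (fun j => `|u ord0 i - u ord0 j|)).
Qed.

Lemma min_rate_le (p : 'I_n -> 'I_n -> R) i j : i != j -> min_rate p <= p i j.
Proof.
move=> ij; rewrite /min_rate (le_trans (bigmin_le _ i _))//.
by apply: (bigmin_le_cond _ (fun j => p i j)); rewrite eq_sym.
Qed.

Lemma min_rate_le1 (p : 'I_n -> 'I_n -> R) : min_rate p <= 1.
Proof. exact: bigmin_le_id. Qed.

Lemma min_rate_gt0 (p : 'I_n -> 'I_n -> R) :
  (forall i j, i != j -> 0 < p i j) -> 0 < min_rate p.
Proof.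
move=> p0; rewrite lt_bigmin// => i _; rewrite lt_bigmin// => j ji.
by apply: p0; rewrite eq_sym.
Qed.

End dynamic_range.

(** * Probability of the cut condition *)

Section cut_condition.
Context (R : realType) (k : outcome_kind) (A : set R)
  (f : R -> R -> R) (T : nat) (d : measure_display)
  (Omega : measurableType d) (P : probability Omega R) (n : nat)
  (u : 'rV[R]_n) (p : 'I_n -> 'I_n -> R)
  (N : 'I_n -> 'I_n -> {RV P >-> nat})
  (X : 'I_n -> 'I_n -> nat -> {RV P >-> R}).

Let cut_event := [set w | cut_condition (fun i j => N i j w)
                            (fun i j t => X i j t w)].

Lemma cut_condition_measurable : measurable cut_event.
Proof.
rewrite -[X in measurable X]setCK not_cut_condition; apply: measurableC.
apply: countable_bigcupT_measurable => // V.
by case: ifP => // _; exact: no_win_measurable.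
Qed.

Lemma not_cut_condition_probability :
  outcome_space k A -> valid_link k A f -> (1 <= T)%N ->
  sampling_model k A f T u p N X -> (4 <= n)%N ->
  10 * ln n%:R <= n%:R * (min_rate p * (1 - C1 k A f (dynamic_range u))) ->
  (P (~` cut_event) <= (n%:R ^- 3)%:E)%E.
Proof.
move=> hA hf T1 hm n4 hn; set C := C1 k A f _ in hn.
have C_le1 : C <= 1 by exact: C1_le1.
have C_ge : 2^-1 <= C by apply: (C1_ge_half hA hf); exact: dynamic_range_ge0.
have p0 : 0 < min_rate p.
  by apply: min_rate_gt0 => i j /(rate_itv hm)/andP[].
have p1 := min_rate_le1 p.
have du i j : - dynamic_range u <= u ord0 i - u ord0 j <= dynamic_range u.
  by rewrite -ler_norml le_dynamic_range.
rewrite not_cut_condition.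
apply: (le_trans (measure_bigcup_finType_le _ _)).
  by move=> V; case: ifP => // _; exact: no_win_measurable.
rewrite (eq_bigr (fun V : {set 'I_n} => if (V != finset.set0) &&
    (V \proper finset.setT) then P (no_win N X V) else 0%E)); last first.
  by move=> V _; case: ifP => // _; rewrite measure0.
rewrite -big_mkcond/=.
apply: (@le_trans _ _ (\sum_(V : {set 'I_n} |
    (V != finset.set0) && (V \proper finset.setT))
    ((1 - min_rate p * (1 - C)) ^+ (#|V| * #|~: V|))%:E)%E).
  apply: lee_sum => V _; apply: (no_win_probability hA hf hm) => //.
  - exact: ltW.
  - by move=> i j ij; exact: min_rate_le.
  - move=> i j; apply: (link_mass_nonpos_le hA hf).
    by rewrite lerNl; case/andP: (du i j).
  - move=> i j; apply: (link_mass_nonneg_le hA hf).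
    by case/andP: (du i j).
rewrite sumEFin lee_fin; apply: sum_cuts_le => //.
apply/andP; split; nra.
Qed.

End cut_condition.

(** From [exp t >= 1 + t] at [t = - ln c] follows [- ln c <= (1 - c) / c], and [1 / c] is at most
    2. *)
Lemma normr_ln_le (R : realType) (c : R) : 2^-1 <= c <= 1 ->
  `|ln c| <= 2 * (1 - c).
Proof.
move=> /andP[c2 c1]; have c0 : 0 < c by lra.
rewrite ler0_norm ?ln_le0//.
have := expR_ge1Dx (- ln c); rewrite expRN lnK ?posrE// => h.
have : c * (1 - ln c) <= 1 by rewrite -ler_pdivlMl// mulr1.
have := ln_le0 c1; nra.
Qed.

(** * Almost sure validity for all large indices *)

Lemma Borel_Cantelli_inv_cube (d : measure_display) (Omega : measurableType d)
    (R : realType) (P : probability Omega R) (S : nat -> set Omega) :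
  (forall n, measurable (S n)) ->
  (\forall n \near \oo, (P (~` S n) <= (n%:R ^- 3)%:E)%E) ->
  {ae P, forall w, \forall n \near \oo, S n w}.
Proof.
move=> mS [n0 _ Sn0].
(* The shift by [n0] makes the bound hold for every [m]; the shift by 2 gives
   [(m + n0 + 2) ^ 3 >= (m + 1) (m + 2)]. *)
pose F m := ~` S (m + n0).+2.
have mF m : measurable (F m) by exact: measurableC.
(* The increments of [h] are [1 / ((m + 1) (m + 2))], so the bounding series telescopes to partial
   sums at most 1. *)
pose h m : R := - m.+1%:R^-1.
have Fle m : (P (F m) <= (h m.+1 - h m)%:E)%E.
  apply: (le_trans (Sn0 _ _)); first by rewrite /=; lia.
  have m0 : 0 < m.+1%:R :> R by rewrite ltr0n.
  have -> : h m.+1 - h m = (m.+1%:R * m.+2%:R)^-1.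
    rewrite /h -[m.+2]addn1 natrD; field; have := ler0n R m => ?.
    by apply/andP; split; rewrite gt_eqF//; lra.
  rewrite lee_fin lef_pV2 ?posrE ?exprn_gt0 ?mulr_gt0 ?ltr0n//.
  have mn : m.+2%:R <= (m + n0).+2%:R :> R by rewrite ler_nat; lia.
  apply: (@le_trans _ _ (m.+2%:R ^+ 3)); last by rewrite lerXn2r ?nnegrE ?ler0n.
  rewrite -natrX -natrM ler_nat; nia.
exists (lim_sup_set F); split.
- by apply: bigcap_measurableType => m _; exact: bigcup_measurable.
- apply: lim_sup_set_cvg0 => //.
  apply: (@le_lt_trans _ _ 1%E); last exact: ltry.
  apply: lime_le; first exact: is_cvg_nneseries.
  apply: nearW => m.
  apply: (@le_trans _ _ (\sum_(0 <= i < m) (h i.+1 - h i)%:E)%E).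
    by apply: lee_sum => i _; exact: Fle.
  rewrite sumEFin telescope_sumr// lee_fin /h invr1 opprK gerDr oppr_le0.
  by rewrite invr_ge0 ler0n.
(* If [w] avoided all [F] from index [m] on, then [S j w] would hold for every [j] from
   [(m + n0).+2] on. *)
- move=> w nSw m _; apply: contrapT => nF; apply: nSw.
  exists (m + n0).+2 => // j /= mj; apply: contrapT => nSj; apply: nF.
  exists (j - n0.+2)%N; first by rewrite /=; lia.
  by rewrite /F (_ : (_ + _).+2 = j)//; lia.
Qed.

Theorem theorem1 (R : realType) (k : outcome_kind) (A : set R)
    (f : R -> R -> R) (T : nat) (d : measure_display)
    (Omega : measurableType d) (P : probability Omega R)
    (u : forall n, 'rV[R]_n) (p : forall n, 'I_n -> 'I_n -> R)
    (N : forall n, 'I_n -> 'I_n -> {RV P >-> nat})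
    (X : forall n, 'I_n -> 'I_n -> nat -> {RV P >-> R})
    (hA : outcome_space k A) (hf : valid_link k A f)
    (hconc : strictly_log_concave A f) (hT : (1 <= T)%N)
    (hmodel : forall n, sampling_model k A f T (u n) (p n) (N n) (X n))
    (hC : \forall n \near \oo, C1 k A f (dynamic_range (u n)) < 1)
    (hlim : (fun n : nat => ln n%:R /
        (n%:R * min_rate (p n) * `|ln (C1 k A f (dynamic_range (u n)))|))
        @ \oo --> (0 : R)) :
  (\forall n \near \oo,
     ((1 - n%:R ^- 3)%:E <=
      P [set w | cut_condition (fun i j => N n i j w)
                   (fun i j t => X n i j t w)])%E) /\
  {ae P, forall w, \forall n \near \oo,
     exists! v : 'rV[R]_n,
       is_mle f (fun i j => N n i j w) (fun i j t => X n i j t w) v}.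
Proof.
pose S n := [set w | cut_condition (fun i j => N n i j w)
                       (fun i j t => X n i j t w)].
have mS n : measurable (S n) by exact: cut_condition_measurable.
have nearS : \forall n \near \oo, (P (~` S n) <= (n%:R ^- 3)%:E)%E.
  near=> n.
  have n4 : (4 <= n)%N by near: n; exact: nbhs_infty_ge.
  have C1_lt : C1 k A f (dynamic_range (u n)) < 1 by near: n.
  (* The constant 20 is the 10 required by the union bound times the 2 lost in [normr_ln_le]. *)
  have hr : `|ln n%:R / (n%:R * min_rate (p n) *
      `|ln (C1 k A f (dynamic_range (u n)))|)| < 20^-1.
    by near: n; apply: cvgr0_norm_lt hlim _ _; rewrite invr_gt0.
  apply: (not_cut_condition_probability hA hf hT (hmodel n) n4).
  set C := C1 k A f _ in C1_lt hr *; set pm := min_rate _ in hr *.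
  have C_ge : 2^-1 <= C by apply: (C1_ge_half hA hf); exact: dynamic_range_ge0.
  have pm0 : 0 < pm.
    by apply: min_rate_gt0 => i j /(rate_itv (hmodel n))/andP[].
  have n0 : 0 < n%:R :> R by rewrite ltr0n; lia.
  have lnC : `|ln C| <= 2 * (1 - C) by apply: normr_ln_le; rewrite C_ge ltW.
  (* Strict positivity comes from [C < 1]. At [C = 1] the denominator would vanish, and the
     quotient, being 0 by convention, would carry no information. *)
  have lnC0 : 0 < `|ln C| by rewrite normr_gt0 lt_eqF// ln_lt0// C1_lt; lra.
  move: hr => /(le_lt_trans (ler_norm _)).
  have np0 : 0 < n%:R * pm by exact: mulr_gt0.
  rewrite ltr_pdivrMr ?mulr_gt0// => h.
  have : n%:R * pm * `|ln C| <= n%:R * pm * (2 * (1 - C)).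
    by rewrite ler_wpM2l// ltW.
  rewrite (mulrA n%:R pm); lra.
split.
  apply: filterS nearS => n; rewrite probability_setC//.
  rewrite -[P (S n)]fineK ?fin_num_measure// -EFinB !lee_fin; lra.
have aeA : {ae P, forall w n i j t, i != j -> (t < N n i j w)%N ->
    A (X n i j t w)}.
  by apply/ae_foralln => n; exact: outcomes_in_space hA hf (hmodel n).
apply: filterS2 aeA (Borel_Cantelli_inv_cube mS nearS) => w wA wS.
(* The index [n = 0], without a first coordinate, is discarded. *)
apply: filterS2 (nbhs_infty_ge 1) wS => -[//|n] _ Sn.
exact: cut_condition_unique_mle hA hf hconc (wA n.+1) Sn.
Unshelve. all: by end_near.
Qed.
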